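(* Fix an integer $d \geq 2$, an integer $k \geq 1$ and an integer $M \geq 2$. Consider a tensor network consisting of $n$ tensors, each having at most $M$ entries, which is to be fully contracted to a scalar. Suppose the tensors can be represented by closed balls (''spheres'') in $\mathbb{R}^d$, one per tensor, with centers and radii chosen such that (i) whenever two tensors share a contracted index, their balls intersect, and (ii) every point of $\mathbb{R}^d$ is contained in at most $k$ of the balls, where $k$ does not depend on $n$. Then, for all sufficiently large $n$, the tensor network can be contracted to a scalar by a sequence of pairwise tensor contractions using at most $$2\, n^{1/\log_2\left(\frac{d+2}{d+1}\right)}\; M^{\,a_d\, k^{1/d}\, n^{1-1/d}}$$ scalar operations (multiplications and additions), where $a_d = \dfrac{c_d}{2-2\left(\frac{d+1}{d+2}\right)^{1-1/d}}$.
   Context: A tensor network is a collection of tensors (multi-dimensional arrays of complex numbers), each index of which has a finite dimension; an index shared by two tensors is contracted, i.e. summed over. Full contraction to a scalar means all indices are summed over. Contracting two tensors pairwise costs a number of scalar multiplications equal to the product of the dimensions of all indices of the two tensors (shared indices counted once), plus at most as many additions. The constant $c_d$ is the constant of the Sphere Separator Theorem (Miller–Teng–Thurston–Vavasis): for every set of $n$ balls in $\mathbb{R}^d$ such that each point lies in at most $k$ balls, there exists a sphere $S$ such that the set $\Gamma_O(S)$ of balls intersecting $S$ satisfies $|\Gamma_O(S)| \leq c_d k^{1/d} n^{1-1/d}$, and the balls strictly inside and strictly outside $S$ form two mutually non-intersecting sets each of size at most $\frac{d+1}{d+2} n$. Known values: $c_2 = 2$, $c_3 < 2.135$, $c_4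 < 2.280$, $c_5 < 2.421$, and in general $c_d < \sqrt{2d/\pi}\,[1+O(1/\log d)]$. *)

(* Defs.v *)
From mathcomp Require Import all_boot.
From Stdlib Require Import Reals.

Set Implicit Arguments.
Unset Strict Implicit.
Unset Printing Implicit Defensive.

(* Points of R^d are represented as functions nat -> R; only the
   coordinates 0 .. d-1 are used. *)
Definition point := nat -> R.

Definition edist (d : nat) (x y : point) : R :=
  sqrt (sum_f_R0 (fun i => Rsqr (Rminus (x i) (y i))) (d.-1)).

Definition in_ball (d : nat) (c : point) (r : R) (x : point) : Prop :=
  (edist d x c <= r)%R.

Definition balls_meet (d : nat) (c1 : point) (r1 : R) (c2 : point) (r2 : R) : Prop :=
  exists x : point, in_ball d c1 r1 x /\ in_ball d c2 r2 x.

Definition count_le (n : nat) (P : nat -> Prop) (b : R) : Prop :=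
  forall l : list nat, List.NoDup l ->
    (forall i, List.In i l -> (i < n)%N /\ P i) ->
    (INR (length l) <= b)%R.

Definition ply_le (d n k : nat) (cen : nat -> point) (rad : nat -> R) : Prop :=
  forall x : point, count_le n (fun i => in_ball d (cen i) (rad i) x) (INR k).

(* The statement of the Sphere Separator Theorem (Miller-Teng-Thurston-Vavasis)
   in dimension d with constant c: for every family of n balls in R^d of ply
   at most k there is a sphere S (center p, radius rho > 0) such that the balls
   meeting S are at most c k^(1/d) n^(1-1/d), and the balls strictly inside S
   and strictly outside S form two mutually non-intersecting families, each
   of size at most (d+1)/(d+2) n. *)
Definition sphere_separator (d : nat) (c : R) : Prop :=
  forall (n k : nat) (cen : nat -> point) (rad : nat -> R),
    (forall i, (i < n)%N -> (0 < rad i)%R) ->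
    ply_le d n k cen rad ->
    exists (p : point) (rho : R),
      (0 < rho)%R /\
      let meetsS i := exists x, in_ball d (cen i) (rad i) x /\ edist d x p = rho in
      let insideS i := forall x, in_ball d (cen i) (rad i) x -> (edist d x p < rho)%R in
      let outsideS i := forall x, in_ball d (cen i) (rad i) x -> (rho < edist d x p)%R in
      count_le n meetsS
        (c * Rpower (INR k) (1 / INR d) * Rpower (INR n) (1 - 1 / INR d))%R /\
      count_le n insideS ((INR d + 1) / (INR d + 2) * INR n)%R /\
      count_le n outsideS ((INR d + 1) / (INR d + 2) * INR n)%R /\
      (forall i j, (i < n)%N -> (j < n)%N -> insideS i -> outsideS j ->
         ~ balls_meet d (cen i) (rad i) (cen j) (rad j)).

(* A closed tensor network: n tensors (numbered 0..n-1) and m indices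
   (numbered 0..m-1); index e has dimension dim e and is shared by the two
   distinct tensors u e and v e (it is contracted, i.e. summed over). *)
Record tnet := TNet {
  tn_n : nat;
  tn_m : nat;
  tn_u : nat -> nat;
  tn_v : nat -> nat;
  tn_dim : nat -> nat }.

Definition tn_wf (T : tnet) : Prop :=
  forall e, (e < tn_m T)%N ->
    [/\ (tn_u T e < tn_n T)%N, (tn_v T e < tn_n T)%N,
        tn_u T e <> tn_v T e & (0 < tn_dim T e)%N].

Definition tn_entries (T : tnet) (i : nat) : nat :=
  (\prod_(e < tn_m T | (tn_u T e == i) || (tn_v T e == i)) tn_dim T e)%N.

(* An intermediate tensor is the result of contracting a group A of original
   tensors; its indices are those with exactly one endpoint in A. *)
Definition is_open (T : tnet) (A : seq nat) (e : nat) : bool :=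
  (tn_u T e \in A) != (tn_v T e \in A).

(* Scalar operations for contracting intermediate tensors A and B:
   P multiplications, P = product of the dimensions of all indices of the two
   tensors (shared ones counted once), plus at most P additions. *)
Definition pair_cost (T : tnet) (A B : seq nat) : nat :=
  (2 * \prod_(e < tn_m T | is_open T A e || is_open T B e) tn_dim T e)%N.

(* contracts T s c : starting from the collection s of intermediate tensors
   (each given by the group of original tensors it comes from), a sequence of
   pairwise contractions reduces it to a single tensor using c operations. *)
Inductive contracts (T : tnet) : seq (seq nat) -> nat -> Prop :=
| contracts_done (A : seq nat) : contracts T [:: A] 0
| contracts_step (s : seq (seq nat)) (A B : seq nat) (rest : seq (seq nat)) (c : nat) :
    perm_eq s (A :: B :: rest) ->
    contracts T ((A ++ B) :: rest) c ->
    contracts T s (pair_cost T A B + c)%N.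

Definition tn_init (T : tnet) : seq (seq nat) :=
  [seq [:: i] | i <- iota 0 (tn_n T)].

Definition ball_repr (d k : nat) (T : tnet) : Prop :=
  exists (cen : nat -> point) (rad : nat -> R),
    (forall i, (i < tn_n T)%N -> (0 < rad i)%R) /\
    (forall e, (e < tn_m T)%N ->
       balls_meet d (cen (tn_u T e)) (rad (tn_u T e)) (cen (tn_v T e)) (rad (tn_v T e))) /\
    ply_le d (tn_n T) k cen rad.

Definition log2 (x : R) : R := (ln x / ln 2)%R.

Definition a_const (d : nat) (c : R) : R :=
  (c / (2 - 2 * Rpower ((INR d + 1) / (INR d + 2)) (1 - 1 / INR d)))%R.

Definition cost_bound (d k M : nat) (c : R) (n : nat) : R :=
  (2 * Rpower (INR n) (1 / log2 ((INR d + 2) / (INR d + 1)))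
     * Rpower (INR M)
         (a_const d c * Rpower (INR k) (1 / INR d) * Rpower (INR n) (1 - 1 / INR d)))%R.

(* Main.v *)
(* Separate a group of [m] tensors by a sphere, put the crossing tensors [O] on
   one side, and recurse.  The edges from [O] to the inside and those from [O]
   to the outside have dimension product at most [M ^ |O|], so on the better
   side the new cut is at most [M ^ (|O| / 2)].  Summed over the levels, the
   sizes [(r^j n)^(1 - 1/d)] form a geometric series, which gives [a_d].

   Adding [O] to a side makes it slightly larger than [r m], which costs an
   extra [O(n^(2 al - 1) + log n)] in the exponent, where [al = 1 - 1/d].  This
   is paid for by stopping early: a group of at most [X = a_d k^(1/d) n^al]
   tensors is contracted in any order at cost [M ^ X], and the part of the series
   saved in this way is of order [n^(al^2)], with [al^2 > 2 al - 1].  Both effects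
   are encoded in the potential [G m = C0 m^al + m^ga - n^ga] with
   [2 al - 1 < ga < al^2]: a group [A] keeps boundary at most [M ^ (X - G |A|)].

   Finally, there are only [n - 1] contractions, and [n - 1] is at most [n ^ p],
   [p] being the exponent in the theorem. *)

Require Import Defs.
From mathcomp Require Import all_boot.
From Stdlib Require Import Reals Lra ClassicalEpsilon.

Set Implicit Arguments.
Unset Strict Implicit.
Unset Printing Implicit Defensive.

(** * Euclidean balls and spheres: convexity and crossing *)

Lemma edistxx d x : edist d x x = 0%R.
Proof.
rewrite /edist -sqrt_0; congr sqrt.
by elim: d.-1 => [|m IH] /=; rewrite ?IH /Rsqr; ring.
Qed.

(** The squared distance to [c] is convex along the segment: coordinatewise the convexity defect is
    [t (1 - t) (x i - y i)^2]. Working with squares avoids the triangle inequality. *)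
Lemma segment_in_ball d c r x y t : (0 <= t <= 1)%R ->
  in_ball d c r x -> in_ball d c r y ->
  in_ball d c r (fun i => x i + t * (y i - x i))%R.
Proof.
rewrite /in_ball /edist => Ht.
set Sx := sum_f_R0 _ _; set Sy := sum_f_R0 (fun i => Rsqr (y i - c i)) _.
set St := sum_f_R0 _ _ => Hx Hy.
have r0 : (0 <= r)%R by have := sqrt_pos Sx; lra.
have Sx0 : (0 <= Sx)%R by apply: cond_pos_sum => i; apply: Rle_0_sqr.
have Sy0 : (0 <= Sy)%R by apply: cond_pos_sum => i; apply: Rle_0_sqr.
have conv : (St <= (1 - t) * Sx + t * Sy)%R.
  rewrite /St /Sx /Sy !scal_sum -plus_sum.
  apply: sum_Rle => i _; rewrite /Rsqr.
  have := Rle_0_sqr (x i - y i); rewrite /Rsqr => Hsq.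
  by have := Rmult_le_pos _ _ (Rmult_le_pos t (1 - t) ltac:(lra) ltac:(lra)) Hsq; lra.
have sqle S : (0 <= S)%R -> (sqrt S <= r)%R -> (S <= r * r)%R.
  move=> S0 H; rewrite -(sqrt_sqrt S) //.
  by apply: Rmult_le_compat => //; apply: sqrt_pos.
have Hle : (St <= r * r)%R.
  have := sqle _ Sx0 Hx; have := sqle _ Sy0 Hy.
  move=> H1 H2; apply: Rle_trans conv _.
  have : ((1 - t) * Sx <= (1 - t) * (r * r))%R by apply: Rmult_le_compat_l; lra.
  have : (t * Sy <= t * (r * r))%R by apply: Rmult_le_compat_l; lra.
  lra.
by rewrite -(sqrt_square r) //; apply: sqrt_le_1_alt.
Qed.

Lemma edist_segment_continuous d (x y p : point) :
  continuity (fun t => edist d (fun i => x i + t * (y i - x i))%R p).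
Proof.
move=> t; rewrite /edist.
apply: (continuity_pt_comp
  (fun t => sum_f_R0 (fun i => Rsqr (x i + t * (y i - x i) - p i)) d.-1) sqrt); last first.
  by apply: continuity_pt_sqrt; apply: cond_pos_sum => i; apply: Rle_0_sqr.
have cont1 i : continuity_pt (fun t => Rsqr (x i + t * (y i - x i) - p i)) t.
  by apply: derivable_continuous_pt; rewrite /Rsqr; reg.
elim: d.-1 => [|m IH] /=; first exact: cont1.
exact: continuity_pt_plus.
Qed.

(** Intermediate value theorem for the distance to [p] along the segment from [x] to [y], which
    stays in the ball. *)
Lemma ball_crosses_sphere d c r x y p rho :
  in_ball d c r x -> in_ball d c r y ->
  (edist d x p < rho)%R -> (rho < edist d y p)%R ->
  exists z, in_ball d c r z /\ edist d z p = rho.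
Proof.
move=> Hx Hy Lx Ly.
pose f t := (edist d (fun i => x i + t * (y i - x i)) p - rho)%R.
have ext u v : (forall i, u i = v i) -> edist d u p = edist d v p.
  by move=> E; congr sqrt; apply: sum_eq => i _; rewrite E.
have fc : continuity f.
  apply: (continuity_minus _ (fun=> rho) (edist_segment_continuous d x y p)).
  by apply: continuity_const.
have f0 : (f 0 < 0)%R.
  by rewrite /f (ext _ x) => [|i]; [lra | ring].
have f1 : (0 < f 1)%R.
  by rewrite /f (ext _ y) => [|i]; [lra | ring].
case: (IVT f 0 1 fc Rlt_0_1 f0 f1) => t [Ht ft].
exists (fun i => x i + t * (y i - x i))%R; split; first exact: segment_in_ball.
by move: ft; rewrite /f; lra.
Qed.

Lemma ball_trichotomy d c r p rho : (0 <= r)%R ->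
  ~ (exists x, in_ball d c r x /\ edist d x p = rho) ->
  ~ (forall x, in_ball d c r x -> (edist d x p < rho)%R) ->
  forall x, in_ball d c r x -> (rho < edist d x p)%R.
Proof.
move=> r0 nmeet nin x Hx; apply: Rnot_le_lt => Lx; apply: nin => y Hy.
apply: Rnot_le_lt => Ly; apply: nmeet.
case: (Rle_lt_or_eq_dec _ _ Lx) => [{}Lx|Ex]; last by exists x.
case: (Rle_lt_or_eq_dec _ _ Ly) => [{}Ly|Ey]; last by exists y.
exact: (ball_crosses_sphere Hx Hy).
Qed.

(** * Sphere separators for subfamilies of balls *)

Lemma In_mem (s : seq nat) i : List.In i s <-> i \in s.
Proof.
elim: s => //= j s IH; rewrite inE; split.
  by case=> [->|/IH ->]; rewrite ?eqxx ?orbT.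
by case/orP => [/eqP ->|/IH]; [left | right].
Qed.

Lemma NoDup_uniq (s : seq nat) : List.NoDup s <-> uniq s.
Proof.
elim: s => [|j s IH] /=; first by split => // _; constructor.
split.
  move=> H; inversion_clear H as [|? ? Hj Hs].
  by apply/andP; split; [apply/negP => /In_mem | apply/IH].
by case/andP => /negP Hj /IH Hs; constructor => // /In_mem.
Qed.

Lemma lengthE (s : seq nat) : length s = size s.
Proof. by elim: s => //= a s ->. Qed.

Lemma count_le_filter (A : seq nat) (p : pred nat) (P : nat -> Prop) b :
  count_le (size A) P b ->
  (forall i, i < size A -> p (nth 0 A i) -> P i) ->
  (INR (size (filter p A)) <= b)%R.
Proof.
move=> H pP; rewrite -{1}(mkseq_nth 0 A) /mkseq filter_map size_map -lengthE.
apply: H; first by apply/NoDup_uniq; rewrite filter_uniq ?iota_uniq.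
move=> i /In_mem; rewrite mem_filter mem_iota /= add0n => /andP[pi iA].
by split; last exact: pP.
Qed.

Lemma ply_subfamily d n k cen rad (A : seq nat) :
  ply_le d n k cen rad -> uniq A -> (forall i, i \in A -> i < n) ->
  ply_le d (size A) k (fun i => cen (nth 0 A i)) (fun i => rad (nth 0 A i)).
Proof.
move=> H uA An x l /NoDup_uniq ul lP.
have := H x (map (nth 0 A) l); rewrite !lengthE size_map; apply.
  apply/NoDup_uniq; rewrite map_inj_in_uniq // => i j /In_mem/lP[iA _] /In_mem/lP[jA _] /eqP.
  by rewrite nth_uniq // => /eqP.
move=> i /In_mem/mapP[j /In_mem/lP[jA Hj] ->]; split => //.
by apply: An; rewrite mem_nth.
Qed.

(** The separator hypothesis speaks of families numbered from 0, so it is applied to the positions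
    in [A]. Each group met in the recursion gets its own sphere in this way. *)
Lemma separate_subfamily d k c n cen rad (A : seq nat) :
  sphere_separator d c ->
  (forall i, i < n -> (0 < rad i)%R) -> ply_le d n k cen rad ->
  uniq A -> (forall i, i \in A -> i < n) ->
  exists I O E : seq nat,
    [/\ perm_eq A (I ++ O ++ E),
        (INR (size O) <= c * Rpower (INR k) (1 / INR d)
                           * Rpower (INR (size A)) (1 - 1 / INR d))%R,
        (INR (size I) <= (INR d + 1) / (INR d + 2) * INR (size A))%R,
        (INR (size E) <= (INR d + 1) / (INR d + 2) * INR (size A))%R &
        forall i j, i \in I -> j \in E ->
          ~ balls_meet d (cen i) (rad i) (cen j) (rad j)].
Proof.
move=> sep rad0 ply uA An.
have An' i : i < size A -> nth 0 A i < n by move=> iA; apply: An; rewrite mem_nth.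
have [|p [rho [_ [HO [HI [HE Hdis]]]]]] :=
  sep _ _ _ _ _ (ply_subfamily ply uA An).
  by move=> i iA; apply/rad0/An'.
pose asb (P : Prop) : bool := excluded_middle_informative P.
have asbP P : reflect P (asb P).
  by rewrite /asb; case: excluded_middle_informative => H; constructor.
pose ins := fun i => asb (forall x, in_ball d (cen i) (rad i) x -> (edist d x p < rho)%R).
pose outs := fun i => asb (forall x, in_ball d (cen i) (rad i) x -> (rho < edist d x p)%R).
(* The separator consists of the balls neither inside nor outside, so that the three parts form a
   partition by construction. [ball_trichotomy] then shows that each of these balls meets the
   sphere. *)
pose B := filter (predC ins) A.
exists (filter ins A), (filter (predC outs) B), (filter outs B); split.
- rewrite -(perm_filterC ins A) perm_cat2l perm_sym perm_catC perm_filterC.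
  exact: perm_refl.
- rewrite /B -filter_predI.
  apply: count_le_filter HO _ => i iA /= /andP[/asbP no /asbP ni].
  apply: NNPP => nm; apply: no; apply: ball_trichotomy nm ni.
  by apply: Rlt_le; apply/rad0/An'.
- by apply: count_le_filter HI _ => i iA /asbP.
- rewrite /B -filter_predI.
  by apply: count_le_filter HE _ => i iA /= /andP[/asbP].
- move=> i j; rewrite !mem_filter => /andP[/asbP Hi iA] /and3P[/asbP Hj _ jA].
  have := Hdis (index i A) (index j A).
  by rewrite !index_mem !nth_index //; apply.
Qed.

(** Test the separator on a single ball: the ratio [(d+1)/(d+2) < 1] leaves no room for it inside or
    outside, so it is in the separator, whose size bound would be nonpositive if [c <= 0]. *)
Lemma sphere_separator_gt0 d c : 0 < d -> sphere_separator d c -> (0 < c)%R.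
Proof.
move=> d0 sep; apply: Rnot_le_lt => c0.
have r0 i : i < 1 -> (0 < (fun=> 1) i)%R by move=> _; lra.
have ply : ply_le d 1 1 (fun=> fun=> 0%R) (fun=> 1%R).
  move=> x l /NoDup_uniq ul lP; apply: le_INR; apply/leP; rewrite lengthE.
  rewrite -(size_iota 0 1); apply: uniq_leq_size => // i /In_mem/lP[].
  by rewrite mem_iota.
have [|I [O [E [pA HO HI HE _]]]] := @separate_subfamily d 1 c 1 _ _ [:: 0] sep r0 ply isT.
  by move=> i; rewrite inE => /eqP ->.
have d1 : (1 <= INR d)%R by rewrite -[1%R]/(INR 1); apply/le_INR/leP.
have rlt1 : ((INR d + 1) / (INR d + 2) < 1)%R.
  by apply: (Rmult_lt_reg_r (INR d + 2)); [lra | field_simplify; lra].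
have small (s : seq nat) x : (INR (size s) <= x)%R -> (x < 1)%R -> s = [::].
  move=> H1 H2; apply: size0nil; case: (size s) H1 => // m.
  by rewrite S_INR; have := pos_INR m; lra.
have I0 : I = [::] by apply: small HI _; rewrite /=; lra.
have E0 : E = [::] by apply: small HE _; rewrite /=; lra.
have O0 : O = [::].
  apply: small HO _; rewrite Rmult_assoc; apply: (@Rle_lt_trans _ 0%R); last lra.
  rewrite -(Rmult_0_l (Rpower (INR 1) (1 / INR d) * Rpower (INR (size [:: 0])) (1 - 1 / INR d))).
  apply: Rmult_le_compat_r c0.
  by apply: Rlt_le; apply: Rmult_lt_0_compat; apply: exp_pos.
by move/perm_size: pA; rewrite I0 O0 E0.
Qed.

(** * Dimension products of sets of indices and of cuts *)

Definition dims (T : tnet) (P : pred nat) : nat := \prod_(e < tn_m T | P e) tn_dim T e.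

Definition cut (T : tnet) (A B : seq nat) : pred nat := fun e =>
  (tn_u T e \in A) && (tn_v T e \in B) || (tn_u T e \in B) && (tn_v T e \in A).

Lemma dims_gt0 T P : tn_wf T -> 0 < dims T P.
Proof. by move=> wf; apply: prodn_cond_gt0 => e _; case: (wf e (ltn_ord e)). Qed.

Lemma dims_leM T (P Q S : pred nat) : tn_wf T ->
  (forall e, e < tn_m T -> P e -> Q e || S e) -> dims T P <= dims T Q * dims T S.
Proof.
move=> wf PQS; rewrite /dims big_mkcond [X in _ <= X * _]big_mkcond.
rewrite [X in _ <= _ * X]big_mkcond -big_split.
apply: leq_prod => e _ /=; have := PQS e (ltn_ord e).
have [_ _ _] := wf e (ltn_ord e).
case: (P e) => [d0 /(_ isT) /orP[] ->|d0 _].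
- by case: ifP => _; rewrite leq_pmulr.
- by case: ifP => _; rewrite leq_pmull.
- by rewrite muln_gt0; do 2!case: ifP => _ //; rewrite ?d0.
Qed.

Lemma dims_mono T (P Q : pred nat) : tn_wf T ->
  (forall e, e < tn_m T -> P e -> Q e) -> dims T P <= dims T Q.
Proof.
move=> wf PQ; have -> : dims T Q = dims T Q * dims T pred0.
  by rewrite [dims T pred0]big_pred0_eq muln1.
by apply: dims_leM => // e em /(PQ e em) ->.
Qed.

Lemma eq_dims T (P Q : pred nat) :
  (forall e, P e = Q e) -> dims T P = dims T Q.
Proof. by move=> PQ; apply: eq_bigl => e. Qed.

Lemma pair_costE T A B :
  pair_cost T A B = 2 * dims T (fun e => is_open T A e || is_open T B e).
Proof. by []. Qed.

(** Exchange the products in the total entry count over [O]: every index in [P] or [Q] contributes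
    its dimension there at least once, through an endpoint in [O], and only once on the left by
    disjointness. *)
Lemma prod_incident_le T M (O : seq nat) (P Q : pred nat) : tn_wf T ->
  (forall i, i \in O -> tn_entries T i <= M) ->
  (forall e, e < tn_m T -> ~~ (P e && Q e)) ->
  (forall e, e < tn_m T -> P e || Q e -> (tn_u T e \in O) || (tn_v T e \in O)) ->
  dims T P * dims T Q <= expn M (size O).
Proof.
move=> wf OM PQ PQO.
have H : \prod_(i <- O) tn_entries T i <= expn M (size O).
  elim: O OM {PQO} => [|i O IH] OM; first by rewrite big_nil.
  rewrite big_cons expnS leq_mul ?OM ?inE ?eqxx // IH // => j jO.
  by rewrite OM // inE jO orbT.
apply: leq_trans H; rewrite /tn_entries.
under [X in _ <= X]eq_bigr => i _ do rewrite big_mkcond.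
rewrite exchange_big /= /dims big_mkcond [X in _ * X <= _]big_mkcond -big_split.
apply: leq_prod => e _ /=.
have [_ _ _ d0] := wf e (ltn_ord e).
have ge1 (s : seq nat) : 0 < \prod_(i <- s)
    (if (tn_u T e == i) || (tn_v T e == i) then tn_dim T e else 1).
  by rewrite prodn_gt0 // => i; case: ifP.
have big t : t \in O -> (tn_u T e == t) || (tn_v T e == t) ->
    tn_dim T e <= \prod_(i <- O)
    (if (tn_u T e == i) || (tn_v T e == i) then tn_dim T e else 1).
  move=> tO te; rewrite (perm_big _ (perm_to_rem tO)) big_cons te.
  exact: leq_pmulr.
have := PQO e (ltn_ord e); have := PQ e (ltn_ord e).
case: (P e); case: (Q e) => //= _ HO; rewrite ?muln1 ?mul1n //.
- by case/orP: (HO isT) => tO; apply: big tO _; rewrite eqxx ?orbT.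
- by case/orP: (HO isT) => tO; apply: big tO _; rewrite eqxx ?orbT.
Qed.

(** With no index between [I] and [E], the two cuts are the [I]-[O] and the [O]-[E] indices, which
    are disjoint and all incident to [O]. *)
Lemma separator_cuts T M (I O E : seq nat) : tn_wf T ->
  uniq (I ++ O ++ E) -> (forall i, i \in O -> tn_entries T i <= M) ->
  (forall e, e < tn_m T -> ~~ cut T I E e) ->
  dims T (cut T I (O ++ E)) * dims T (cut T (I ++ O) E) <= expn M (size O).
Proof.
move=> wf uIOE OM noIE.
have dj x : ~~ ((x \in I) && (x \in O)) && ~~ ((x \in I) && (x \in E)) &&
    ~~ ((x \in O) && (x \in E)).
  move: uIOE; rewrite !cat_uniq => /and3P[_ /hasPn H1 /and3P[_ /hasPn H2 _]].
  case xI: (x \in I).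
    have := H1 x; rewrite mem_cat /= xI.
    by case: (x \in O) => [/(_ isT)|] //; case: (x \in E) => [/(_ isT)|].
  case xO: (x \in O) => //=; case xE: (x \in E) => //.
  by have := H2 _ xE; rewrite /= xO.
apply: prod_incident_le => // e em.
  have := noIE e em; have := dj (tn_u T e); have := dj (tn_v T e).
  rewrite /cut !mem_cat.
  case: (tn_u T e \in I); case: (tn_u T e \in O); case: (tn_u T e \in E) => //=;
  by case: (tn_v T e \in I); case: (tn_v T e \in O); case: (tn_v T e \in E).
have := noIE e em; have := dj (tn_u T e); have := dj (tn_v T e).
rewrite /cut !mem_cat.
case: (tn_u T e \in I); case: (tn_u T e \in O); case: (tn_u T e \in E) => //=;
by case: (tn_v T e \in I); case: (tn_v T e \in O); case: (tn_v T e \in E).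
Qed.

(** An index open in a part is either open in [A] or runs between the parts. This controls both the
    cost of the last contraction and the boundary of each part. *)
Lemma dims_pair_le T A A1 A2 : tn_wf T -> perm_eq A (A1 ++ A2) ->
  dims T (fun e => is_open T A1 e || is_open T A2 e)
    <= dims T (is_open T A) * dims T (cut T A1 A2).
Proof.
move=> wf pA; apply: dims_leM => // e _.
rewrite /is_open /cut !(perm_mem pA) !mem_cat.
by case: (tn_u T e \in A1); case: (tn_u T e \in A2);
   case: (tn_v T e \in A1); case: (tn_v T e \in A2).
Qed.

(** * Composing contraction sequences *)

Lemma contracts_perm T s s' c : perm_eq s' s -> contracts T s c -> contracts T s' c.
Proof.
move=> ps cs; case: cs ps => [A|s0 A B rest c' ps0 cs'] ps.
  by rewrite (perm_small_eq _ ps) //; apply: contracts_done.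
by apply: contracts_step cs'; apply: perm_trans ps ps0.
Qed.

(* In continuation form, because [contracts] only describes runs that end with a
   single tensor. *)
Definition assembles (T : tnet) (A : seq nat) (c : nat) : Prop :=
  exists2 A', perm_eq A A' &
    forall rest c', contracts T (A' :: rest) c' ->
      contracts T ([seq [:: i] | i <- A] ++ rest) (c + c').

Lemma assembles1 T i : assembles T [:: i] 0.
Proof. by exists [:: i]. Qed.

Lemma assembles_cat T A A1 A2 c1 c2 : perm_eq A (A1 ++ A2) ->
  assembles T A1 c1 -> assembles T A2 c2 ->
  assembles T A (c1 + c2 + pair_cost T A1 A2).
Proof.
move=> pA [B1 p1 H1] [B2 p2 H2]; exists (B1 ++ B2).
  by apply: perm_trans pA _; apply: perm_cat.
move=> rest c' Hc.
(* Each part is assembled only up to reordering, but the cost depends on membership alone. *)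
have -> : pair_cost T A1 A2 = pair_cost T B1 B2.
  rewrite !pair_costE; congr muln; apply: eq_dims => e.
  by rewrite /is_open !(perm_mem p1) !(perm_mem p2).
rewrite -addnA -addnA; apply: (@contracts_perm _ ([seq [:: i] | i <- A1] ++
    [seq [:: i] | i <- A2] ++ rest)).
  by rewrite catA perm_cat2r -map_cat perm_map.
apply: H1; apply: (@contracts_perm _ ([seq [:: i] | i <- A2] ++ B1 :: rest)).
  by rewrite perm_sym -(cat1s B1 rest) perm_catCA.
apply: H2; apply: (@contracts_step T _ B1 B2 rest c' _ Hc).
by rewrite -[B2 :: B1 :: rest]/([:: B2] ++ [:: B1] ++ rest) perm_catCA.
Qed.

(** Tensors are absorbed one at a time; each contraction involves only indices incident to the
    group, hence at most [M ^ |A|] multiplications. This handles the groups below the threshold. *)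
Lemma assembles_sequentially T M A : tn_wf T -> A != [::] -> 0 < M ->
  (forall i, i \in A -> tn_entries T i <= M) ->
  exists2 c, assembles T A c & c <= (size A).-1 * (2 * expn M (size A)).
Proof.
move=> wf nA M0; elim: A nA => // i [|j A] IH _ HM.
  by exists 0 => //; apply: assembles1.
have [|t tA|c Hc lec] := IH; [by []|by rewrite HM // inE tA orbT|].
exists (0 + c + pair_cost T [:: i] (j :: A)).
  by apply: assembles_cat (assembles1 T i) Hc.
set B := j :: A in Hc lec HM *.
rewrite add0n -[(size (i :: B)).-1]/((size B).-1.+1) mulSn addnC leq_add //.
  rewrite pair_costE leq_pmul2l // -[X in X <= _]muln1.
  (* An empty second factor brings the goal into the two-product form of [prod_incident_le]. *)
  have <- : dims T pred0 = 1 by apply: big_pred0_eq.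
  apply: prod_incident_le => // e em; first by rewrite andbF.
  rewrite orbF /is_open !inE.
  by case: (_ == i); case: (_ == j); case: (_ == i); case: (_ == j);
    case: (_ \in A); case: (_ \in A).
apply: leq_trans lec _; rewrite leq_mul2l; apply/orP; right.
by rewrite leq_mul2l /= leq_pexp2l.
Qed.

(** * Real powers and the potential inequality *)

Section RealPowers.
Local Open Scope R_scope.

Lemma Rpower_gt0 x y : 0 < Rpower x y.
Proof. exact: exp_pos. Qed.

Lemma Rpower_le_base x y p : 0 <= p -> 0 < x -> x <= y -> Rpower x p <= Rpower y p.
Proof. by move=> p0 x0 xy; apply: Rle_Rpower_l. Qed.

Lemma Rpower_large p B : 0 < p -> exists2 x0, 0 < x0 & forall x, x0 <= x -> B <= Rpower x p.
Proof.
move=> p0; exists (Rpower (Rmax B 1) (/ p)); first exact: Rpower_gt0.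
move=> x Hx; apply: Rle_trans (Rmax_l B 1) _.
have B0 : 0 < Rmax B 1 by have := Rmax_r B 1; lra.
have <- : Rpower (Rpower (Rmax B 1) (/ p)) p = Rmax B 1.
  by rewrite Rpower_mult Rinv_l ?Rpower_1 //; lra.
by apply: Rpower_le_base => //; [lra | apply: Rpower_gt0].
Qed.

Lemma Rpower_one_plus_le u p : 0 <= u -> p <= 1 -> Rpower (1 + u) p <= 1 + u.
Proof.
move=> u0 p1; case: (Req_dec u 0) => [->|un0].
  by rewrite Rplus_0_r /Rpower ln_1 Rmult_0_r exp_0; lra.
rewrite -[X in _ <= X]Rpower_1; last lra.
by apply: Rle_Rpower; lra.
Qed.

Lemma Rpower_in01 x p : 0 < x < 1 -> 0 < p -> 0 < Rpower x p < 1.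
Proof.
move=> x01 p0; split; first exact: Rpower_gt0.
have := @exp_increasing (p * ln x) 0; rewrite exp_0; apply.
have lx : ln x < 0 by rewrite -ln_1; apply: ln_increasing; lra.
by have := Rmult_lt_0_compat p (- ln x) ltac:(lra) ltac:(lra); lra.
Qed.

(* The exponent [m^ga] absorbs the [O(m^(2 al - 1))] excess caused by adding
   the [C m^al] separator vertices to one of the two sides. *)
Lemma potential_step r C al ga :
  0 < r < 1 -> 0 < C -> 0 < al < 1 -> 2 * al - 1 < ga -> 0 < ga ->
  let C0 := C / (2 - 2 * Rpower r al) in
  exists2 m0, 0 < m0 & forall m, m0 <= m ->
    r * m + C * Rpower m al < m /\
    C0 * Rpower (r * m + C * Rpower m al) al + Rpower (r * m + C * Rpower m al) ga
      + C * Rpower m al / 2 <= C0 * Rpower m al + Rpower m ga.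
Proof.
move=> r01 C0' al01 ga2 ga0 C0.
set q := Rpower r al in C0 *.
have q01 : 0 < q < 1 by apply: Rpower_in01; lra.
have C0gt : 0 < C0 by apply: Rdiv_lt_0_compat; lra.
(* The midpoint between [r] and 1: for large [m] the enlarged side still has size at most [r' m], so
   its [ga]-th power drops by the factor [g < 1]. *)
set r' := (1 + r) / 2.
set g := Rpower r' ga.
have [_ g1] : 0 < g < 1 by apply: Rpower_in01; rewrite ?/r'; lra.
(* Beyond [m1] the separator is at most [(1 - r) m / 2]; beyond [m2] the excess of order
   [m^(2 al - 1)] is at most the drop [(1 - g) m^ga]. *)
have [m1 m1gt H1] := @Rpower_large (1 - al) (2 * C / (1 - r)) ltac:(lra).
have [m2 m2gt H2] := @Rpower_large (ga - (2 * al - 1)) (C0 * q / r * C / (1 - g)) ltac:(lra).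
exists (Rmax m1 m2); first by have := Rmax_l m1 m2; lra.
move=> m Hm.
have m1m : m1 <= m by have := Rmax_l m1 m2; lra.
have m2m : m2 <= m by have := Rmax_r m1 m2; lra.
have m0 : 0 < m by lra.
have {}H1 : C * Rpower m al <= (1 - r) / 2 * m.
  have := H1 _ m1m => H.
  have Em : m = Rpower m (1 - al) * Rpower m al.
    by rewrite -Rpower_plus (_ : 1 - al + al = 1) ?Rpower_1 //; ring.
  rewrite {2}Em -Rmult_assoc; apply: Rmult_le_compat_r; first exact/Rlt_le/Rpower_gt0.
  have := Rmult_le_compat_l ((1 - r) / 2) _ _ ltac:(lra) H.
  rewrite (_ : (1 - r) / 2 * (2 * C / (1 - r)) = C) //; field; lra.
have Cm0 : 0 < C * Rpower m al by apply: Rmult_lt_0_compat => //; apply: Rpower_gt0.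
have rm0 : 0 < r * m by apply: Rmult_lt_0_compat; lra.
have rm1 : 0 < (1 - r) * m by apply: Rmult_lt_0_compat; lra.
split; first by lra.
set y := r * m + C * Rpower m al.
have Hga : Rpower y ga <= g * Rpower m ga.
  rewrite /g Rpower_mult_distr ?/r' //; last lra.
  apply: Rpower_le_base; rewrite /y; lra.
(* Factor [y = r m (1 + u)] with [u] of order [m^(al - 1)] and use [(1 + u)^al <= 1 + u]. *)
have Hal : Rpower y al <= q * Rpower m al + q / r * C * Rpower m (2 * al - 1).
  set u := C / r * Rpower m (al - 1).
  have u0 : 0 < u by apply: Rmult_lt_0_compat; [apply: Rdiv_lt_0_compat; lra | apply: Rpower_gt0].
  have Em : m * Rpower m (al - 1) = Rpower m al.
    by rewrite -{1}(Rpower_1 m m0) -Rpower_plus; congr Rpower; ring.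
  have Ey : y = r * m * (1 + u).
    rewrite /y /u -Em; field; lra.
  have Em2 : Rpower m al * Rpower m (al - 1) = Rpower m (2 * al - 1).
    by rewrite -Rpower_plus; congr Rpower; ring.
  rewrite Ey -!Rpower_mult_distr //; try lra.
  rewrite -/q -Em2.
  have := Rpower_one_plus_le (Rlt_le _ _ u0) (p := al) ltac:(lra) => Hu.
  have qm : 0 <= q * Rpower m al by apply: Rmult_le_pos; [lra | exact/Rlt_le/Rpower_gt0].
  apply: Rle_trans (Rmult_le_compat_l _ _ _ qm Hu) _.
  by apply: Req_le; rewrite /u; field; lra.
have {}H2 : C0 * (q / r * C * Rpower m (2 * al - 1)) <= (1 - g) * Rpower m ga.
  have := H2 _ m2m => H.
  have -> : Rpower m ga = Rpower m (ga - (2 * al - 1)) * Rpower m (2 * al - 1).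
    by rewrite -Rpower_plus; congr Rpower; ring.
  set P := Rpower m (2 * al - 1).
  have -> : C0 * (q / r * C * P) = (1 - g) * (C0 * q / r * C / (1 - g)) * P by field; lra.
  rewrite -Rmult_assoc; apply: Rmult_le_compat_r; first exact/Rlt_le/Rpower_gt0.
  by apply: Rmult_le_compat_l H; lra.
(* The equation [C0 q + C / 2 = C0] characterises [C0] as the sum of the geometric series with first
   term [C / 2] and ratio [q]. *)
have EC : C0 * q * Rpower m al + C * Rpower m al / 2 = C0 * Rpower m al.
  by rewrite /C0; field; lra.
have := Rmult_le_compat_l C0 _ _ ltac:(lra) Hal.
rewrite Rmult_plus_distr_l -Rmult_assoc; lra.
Qed.

End RealPowers.

(** * The divide-and-conquer recursion *)

Lemma INR_expn M n : 0 < M -> INR (expn M n) = Rpower (INR M) (INR n).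
Proof.
move=> M0; have M0R : (0 < INR M)%R by apply/lt_0_INR/ltP.
rewrite Rpower_pow //; elim: n => [|n IH] //=.
by rewrite expnS -multE mult_INR IH.
Qed.

Lemma sqrt_power_bound M x n b : 0 < M -> x * x <= expn M n -> (INR n <= b)%R ->
  (INR x <= Rpower (INR M) (b / 2))%R.
Proof.
move=> M0 /leP/le_INR; rewrite -multE mult_INR INR_expn // => Hx nb.
apply: Rsqr_incr_0_var; last exact/Rlt_le/Rpower_gt0.
rewrite /Rsqr -Rpower_plus; apply: Rle_trans Hx _; apply: Rle_Rpower.
  by rewrite -[1%R]/(INR 1); apply/le_INR/leP.
by lra.
Qed.

(** Here [s] bounds separators, [X] is the threshold and [G] the potential. Splitting multiplies the
    boundary by at most [M ^ (s m / 2)]: [s m / 2 <= G m] keeps the contraction within [M ^ X], and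
    the drop of [G] restores the invariant on both sides. *)
Lemma assembles_recursively T M (r X : R) (s G : nat -> R) :
  tn_wf T -> 0 < M -> (forall i, i < tn_n T -> tn_entries T i <= M) ->
  (forall A : seq nat, uniq A -> (forall i, i \in A -> i < tn_n T) ->
     exists I O E : seq nat,
       [/\ perm_eq A (I ++ O ++ E), (INR (size O) <= s (size A))%R,
           (INR (size I) <= r * INR (size A))%R,
           (INR (size E) <= r * INR (size A))%R &
           forall e, e < tn_m T -> ~~ cut T I E e]) ->
  (forall m, (X < INR m)%R -> (s m / 2 <= G m)%R /\
     forall m', (INR m' <= r * INR m + s m)%R ->
       m' < m /\ (0 < m' -> (G m' + s m / 2 <= G m)%R)) ->
  forall A : seq nat, uniq A -> (forall i, i \in A -> i < tn_n T) -> A != [::] ->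
    (INR (dims T (is_open T A)) <= Rpower (INR M) (X - G (size A)))%R ->
    exists2 c, assembles T A c &
      (INR c <= (INR (size A) - 1) * (2 * Rpower (INR M) X))%R.
Proof.
move=> wf M0 HM Hsep HG A.
have M1 : (1 <= INR M)%R by rewrite -[1%R]/(INR 1); apply/le_INR/leP.
have [b] := ubnP (size A); elim: b A => // b IH A sA uA An nA HP.
have A0 : 0 < size A by case: (A) nA.
case: (Rle_lt_dec (INR (size A)) X) => [AX|AX].
  have [c Hc cle] := assembles_sequentially wf nA M0 (fun i iA => HM i (An i iA)).
  exists c => //; apply: Rle_trans (le_INR _ _ (leP cle)) _.
  rewrite -!multE !mult_INR INR_expn // -subn1 -minusE minus_INR; last exact/leP.
  apply: Rmult_le_compat_l; first by have := le_INR _ _ (leP A0); rewrite /=; lra.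
  by apply: Rmult_le_compat_l; [rewrite /=; lra | apply: Rle_Rpower].
have [sG stepG] := HG _ AX.
have [I [O [E [pA HO HI HE noIE]]]] := Hsep A uA An.
have O0 := pos_INR (size O).
suff key (A1 A2 : seq nat) : perm_eq A (A1 ++ A2) ->
    (INR (size A1) <= r * INR (size A) + s (size A))%R ->
    (INR (size A2) <= r * INR (size A) + s (size A))%R ->
    dims T (cut T A1 A2) * dims T (cut T A1 A2) <= expn M (size O) ->
    exists2 c, assembles T A c &
      (INR c <= (INR (size A) - 1) * (2 * Rpower (INR M) X))%R.
  have uIOE : uniq (I ++ O ++ E) by rewrite -(perm_uniq pA).
  have HMO i : i \in O -> tn_entries T i <= M.
    by move=> iO; apply/HM/An; rewrite (perm_mem pA) !mem_cat iO orbT.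
  have Hcut := separator_cuts wf uIOE HMO noIE.
  (* The separator joins the side giving the smaller cut, whose square is at most the product of the
     two. *)
  have [le|le] := leqP (dims T (cut T I (O ++ E))) (dims T (cut T (I ++ O) E)).
    apply: (key I (O ++ E)) => //.
    - by lra.
    - by rewrite size_cat -plusE plus_INR; lra.
    - by apply: leq_trans Hcut; rewrite leq_mul2l le orbT.
  apply: (key (I ++ O) E) => //.
  - by rewrite -catA.
  - by rewrite size_cat -plusE plus_INR; lra.
  - by lra.
  - by apply: leq_trans Hcut; rewrite leq_mul2r (ltnW le) orbT.
move=> {HI HE noIE} {}pA H1 H2 Hcut.
have cutle := sqrt_power_bound M0 Hcut HO.
have [lt1 G1] := stepG _ H1; have [lt2 G2] := stepG _ H2.
have Esize : size A = size A1 + size A2 by rewrite (perm_size pA) size_cat.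
(* Each part is strictly smaller than [A], so the other one is nonempty. *)
have pos1 : 0 < size A1 by move: lt2; rewrite Esize -{1}(add0n (size A2)) ltn_add2r.
have pos2 : 0 < size A2 by move: lt1; rewrite Esize -{1}(addn0 (size A1)) ltn_add2l.
have HPcut : (INR (dims T (is_open T A) * dims T (cut T A1 A2))
    <= Rpower (INR M) (X - G (size A) + s (size A) / 2))%R.
  rewrite -multE mult_INR Rpower_plus.
  by apply: Rmult_le_compat => //; apply: pos_INR.
have HP12 := dims_pair_le wf pA.
have uA12 : uniq (A1 ++ A2) by rewrite -(perm_uniq pA).
have side (B : seq nat) : B = A1 \/ B = A2 -> 0 < size B -> size B < size A ->
    (0 < size B -> (G (size B) + s (size A) / 2 <= G (size A))%R) ->
    exists2 c, assembles T B c &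
      (INR c <= (INR (size B) - 1) * (2 * Rpower (INR M) X))%R.
  move=> BA B0 ltB GB; apply: IH.
  - exact: leq_trans ltB _.
  - by move: uA12; rewrite cat_uniq => /and3P[? _ ?]; case: BA => ->.
  - move=> i iB; apply: An; rewrite (perm_mem pA) mem_cat.
    by case: BA iB => -> ->; rewrite ?orbT.
  - by case: (B) B0.
  - apply: (@Rle_trans _ (INR (dims T (is_open T A) * dims T (cut T A1 A2)))).
      apply/le_INR/leP; apply: leq_trans HP12; apply: dims_mono => // e _.
      by case: BA => -> ->; rewrite ?orbT.
    by apply: Rle_trans HPcut _; apply: Rle_Rpower => //; have := GB B0; lra.
have [c1 Hc1 le1] := side A1 (or_introl erefl) pos1 lt1 G1.
have [c2 Hc2 le2] := side A2 (or_intror erefl) pos2 lt2 G2.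
exists (c1 + c2 + pair_cost T A1 A2); first exact: assembles_cat pA Hc1 Hc2.
have Hpair : (INR (pair_cost T A1 A2) <= 2 * Rpower (INR M) X)%R.
  rewrite pair_costE -multE mult_INR; apply: Rmult_le_compat_l; first by rewrite /=; lra.
  apply: Rle_trans (le_INR _ _ (leP HP12)) _.
  by apply: Rle_trans HPcut _; apply: Rle_Rpower => //; lra.
rewrite Esize; move: (pair_cost T A1 A2) Hpair => p Hp; rewrite -!plusE !plus_INR.
lra.
Qed.

(** * Choice of exponents and thresholds, and the final bound *)

Theorem theorem1 (d k M : nat) (c : R) :
  (2 <= d)%N -> (1 <= k)%N -> (2 <= M)%N ->
  sphere_separator d c ->
  exists N : nat, forall T : tnet,
    (N <= tn_n T)%N ->
    tn_wf T ->
    (forall i, (i < tn_n T)%N -> (tn_entries T i <= M)%N) ->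
    ball_repr d k T ->
    exists ops : nat,
      contracts T (tn_init T) ops /\ (INR ops <= cost_bound d k M c (tn_n T))%R.
Proof.
move=> d2 k1 M2 sep.
have d2R : (2 <= INR d)%R by rewrite -[2%R]/(INR 2); apply/le_INR/leP.
have c0 : (0 < c)%R by apply: sphere_separator_gt0 sep; apply: ltnW.
pose dl := (1 / INR d)%R.
pose r := ((INR d + 1) / (INR d + 2))%R.
pose al := (1 - dl)%R.
(* The midpoint of [2 al - 1 = 1 - 2 dl] and [al^2 = 1 - 2 dl + dl^2]; it is positive because
   [d >= 2] gives [dl <= 1/2]. *)
pose ga := (1 - 2 * dl + dl * dl / 2)%R.
pose C := (c * Rpower (INR k) dl)%R.
pose C0 := (C / (2 - 2 * Rpower r al))%R.
have dl0 : (0 < dl)%R by apply: Rdiv_lt_0_compat; lra.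
have dl2 : (dl <= 1 / 2)%R.
  by rewrite /dl /Rdiv !Rmult_1_l; apply: Rinv_le_contravar; lra.
have dd0 : (0 < dl * dl)%R by apply: Rmult_lt_0_compat.
have r01 : (0 < r < 1)%R.
  split; first by apply: Rdiv_lt_0_compat; lra.
  by apply: (Rmult_lt_reg_r (INR d + 2)); rewrite /r; [lra | field_simplify; lra].
have C_gt0 : (0 < C)%R by apply: Rmult_lt_0_compat => //; apply: Rpower_gt0.
have al01 : (0 < al < 1)%R by rewrite /al; lra.
have ga2 : (2 * al - 1 < ga)%R by rewrite /ga /al; lra.
have ga0 : (0 < ga)%R by rewrite /ga; lra.
have gaal : (0 < al * al - ga)%R by rewrite /al /ga; lra.
have q01 : (0 < Rpower r al < 1)%R by apply: Rpower_in01; lra.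
have C00 : (0 < C0)%R by apply: Rdiv_lt_0_compat; lra.
have C0C : (0 < C0 - C / 2)%R.
  have -> : (C0 - C / 2 = C0 * Rpower r al)%R by rewrite /C0; field; lra.
  by apply: Rmult_lt_0_compat; lra.
have [m0 m00 Hstep] := potential_step r01 C_gt0 al01 ga2 ga0.
rewrite -/C0 in Hstep.
(* [n1] ensures [m0 <= X], so that the potential inequality holds above the threshold; [n2] ensures
   [n^ga <= (C0 - C / 2) X^al], which yields [s m / 2 <= G m] there. *)
have [n1 _ Hn1] := @Rpower_large al (m0 / C0) ltac:(lra).
have [n2 _ Hn2] := @Rpower_large (al * al - ga) (/ ((C0 - C / 2) * Rpower C0 al)) gaal.
have [N HN] := INR_unbounded (Rmax n1 n2).
exists N.+1 => T NT wf HM [cen [rad [rad0 [meets ply]]]].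
set n := tn_n T in NT HM rad0 ply *.
have n0 : 0 < n by apply: leq_ltn_trans NT.
have n1R : (1 <= INR n)%R by rewrite -[1%R]/(INR 1); apply/le_INR/leP.
have nN : (Rmax n1 n2 <= INR n)%R.
  by apply: Rle_trans (Rlt_le _ _ HN) _; apply/le_INR/leP/ltnW.
pose X := (C0 * Rpower (INR n) al)%R.
have {Hn1} m0X : (m0 <= X)%R.
  have := Hn1 (INR n) (Rle_trans _ _ _ (Rmax_l _ _) nN) => H.
  have := Rmult_le_compat_l C0 _ _ (Rlt_le _ _ C00) H.
  by rewrite (_ : C0 * (m0 / C0) = m0)%R //; field; lra.
have X0 : (0 < X)%R by lra.
have {Hn2} Hkappa : (Rpower (INR n) ga <= (C0 - C / 2) * Rpower X al)%R.
  have := Hn2 (INR n) (Rle_trans _ _ _ (Rmax_r _ _) nN) => H.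
  have P0 := Rpower_gt0 (INR n) al.
  rewrite /X -Rpower_mult_distr // Rpower_mult.
  have -> : (al * al = (al * al - ga) + ga)%R by ring.
  rewrite Rpower_plus -!Rmult_assoc -[X in (X <= _)%R]Rmult_1_l.
  apply: Rmult_le_compat_r; first exact/Rlt_le/Rpower_gt0.
  have K0 : (0 < (C0 - C / 2) * Rpower C0 al)%R.
    by apply: Rmult_lt_0_compat => //; apply: Rpower_gt0.
  rewrite -(Rinv_r ((C0 - C / 2) * Rpower C0 al)); last lra.
  by apply: Rmult_le_compat_l => //; lra.
pose s m := (C * Rpower (INR m) al)%R.
pose G m := (C0 * Rpower (INR m) al + Rpower (INR m) ga - Rpower (INR n) ga)%R.
have Hsep (A : seq nat) : uniq A -> (forall i, i \in A -> i < tn_n T) ->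
     exists I O E : seq nat,
       [/\ perm_eq A (I ++ O ++ E), (INR (size O) <= s (size A))%R,
           (INR (size I) <= r * INR (size A))%R,
           (INR (size E) <= r * INR (size A))%R &
           forall e, e < tn_m T -> ~~ cut T I E e].
  move=> uA An.
  have [I [O [E [pA HO HI HE far]]]] := separate_subfamily sep rad0 ply uA An.
  exists I, O, E; split=> // e em; apply/negP => /orP[] /andP[ue ve].
    exact: (far _ _ ue ve (meets e em)).
  by have [x [xu xv]] := meets e em; apply: (far _ _ ve ue); exists x.
have HG m : (X < INR m)%R -> (s m / 2 <= G m)%R /\
     forall m', (INR m' <= r * INR m + s m)%R ->
       m' < m /\ (0 < m' -> (G m' + s m / 2 <= G m)%R).
  move=> Xm; have [lt_m le_G] := Hstep (INR m) (Rle_trans _ _ _ m0X (Rlt_le _ _ Xm)).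
  split.
    have Pm : (Rpower X al <= Rpower (INR m) al)%R by apply: Rpower_le_base; lra.
    have := Rmult_le_compat_l _ _ _ (Rlt_le _ _ C0C) Pm.
    have := Rpower_gt0 (INR m) ga.
    by rewrite /s /G; lra.
  move=> m' Hm'; split; first by apply/ltP/INR_lt; rewrite /s in Hm'; lra.
  move=> m'0; have m'R : (0 < INR m')%R by apply/lt_0_INR/ltP.
  have := @Rpower_le_base _ _ al ltac:(lra) m'R Hm'.
  have := @Rpower_le_base _ _ ga ltac:(lra) m'R Hm'.
  rewrite -/(s m) in le_G *; move=> Hga Hal.
  have := Rmult_le_compat_l _ _ _ (Rlt_le _ _ C00) Hal.
  by rewrite /G; lra.
have M0 : 0 < M by apply: ltnW.
have [||||ops [A' pA Hops] le_ops] :=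
  assembles_recursively wf M0 HM Hsep HG (A := iota 0 n).
- exact: iota_uniq.
- by move=> i; rewrite mem_iota.
- by rewrite -size_eq0 size_iota -lt0n.
(* The full network has no open index, so its boundary is 1; subtracting [n^ga] in [G] makes
   [G n = X], and the required bound is [M ^ 0]. *)
- rewrite /dims big_pred0 => [|e].
    rewrite size_iota /G /X (_ : _ - _ = 0)%R; last ring.
    by rewrite Rpower_O /=; [lra | apply/lt_0_INR/ltP].
  have [ue ve _ _] := wf e (ltn_ord e).
  by rewrite /is_open !mem_iota /= !add0n ue ve.
exists ops; split.
  by have := Hops [::] 0 (contracts_done T A'); rewrite addn0 cats0.
apply: Rle_trans le_ops _; rewrite size_iota /cost_bound.
have -> : (a_const d c * Rpower (INR k) (1 / INR d) * Rpower (INR n) (1 - 1 / INR d) = X)%R.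
  by rewrite /X /C0 /C /a_const -/r -/dl -/al; field; lra.
rewrite Rmult_comm Rmult_assoc [X in (_ <= X)%R]Rmult_assoc; apply: Rmult_le_compat_l; first lra.
rewrite Rmult_comm; apply: Rmult_le_compat_r; first exact/Rlt_le/Rpower_gt0.
set y := ((INR d + 2) / (INR d + 1))%R.
(* [y <= 2] gives [log2 y <= 1], so the exponent of [n] is at least 1 and dominates the [n - 1]
   contractions. *)
have y12 : (1 < y <= 2)%R.
  split; first by apply: (Rmult_lt_reg_r (INR d + 1)); rewrite /y; [lra | field_simplify; lra].
  by apply: (Rmult_le_reg_r (INR d + 1)); rewrite /y; [lra | field_simplify; lra].
have ly0 : (0 < ln y)%R by rewrite -ln_1; apply: ln_increasing; lra.
have ly2 : (ln y <= ln 2)%R.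
  case: (Rle_lt_or_eq_dec _ _ (proj2 y12)) => [lt|->]; last lra.
  by apply/Rlt_le/ln_increasing; lra.
have p1 : (1 <= 1 / log2 y)%R.
  have -> : (1 / log2 y = ln 2 / ln y)%R by rewrite /log2; field; lra.
  by apply: (Rmult_le_reg_r (ln y)) => //; rewrite /Rdiv Rmult_assoc Rinv_l; lra.
have := Rle_Rpower (INR n) 1 _ n1R p1; rewrite Rpower_1; lra.
Qed.
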